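(* Let $S$ and $T$ be semigroups. If the direct product $S\times T$ is strongly subsemigroup separable, then both $S$ and $T$ are strongly subsemigroup separable.
   Context: Semigroups are nonempty; $S\times T$ is the direct product with componentwise multiplication. A semigroup $S$ is strongly subsemigroup separable if for every $s\in S$ and every subsemigroup $Y$ of $S$ with $s\notin Y$ there exist a finite semigroup $P$ and a semigroup homomorphism $\phi:S\to P$ with $\phi(s)\notin\phi(Y)$. *)

(* Defs.v *)
From mathcomp Require Import all_boot.
From mathcomp Require Import classical_sets cardinality.

Set Implicit Arguments.
Unset Strict Implicit.
Unset Printing Implicit Defensive.

Local Open Scope classical_set_scope.
Local Open Scope group_scope.

(* Subsemigroups, like semigroups, are nonempty. *)
Definition subsemigroup (S : semigroupType) (Y : set S) : Prop :=
  Y !=set0 /\ (forall x y : S, Y x -> Y y -> Y (x * y)).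

(* P needs no nonemptiness condition: it contains phi s. *)
Definition strongly_subsemigroup_separable (S : semigroupType) : Prop :=
  forall (s : S) (Y : set S), subsemigroup Y -> ~ Y s ->
    exists (P : semigroupType) (phi : {multiplicative S -> P}),
      finite_set [set: P] /\ ~ (phi @` Y) (phi s).

(* Main.v *)
Require Import Defs.
From HB Require Import structures.
From mathcomp Require Import all_boot.
From mathcomp Require Import boolp classical_sets cardinality.

Set Implicit Arguments.
Unset Strict Implicit.
Unset Printing Implicit Defensive.

(** Let [Y] be a subsemigroup of [S] with [s] not in [Y], fix [t] in [T], and
let [phi] be a homomorphism from [S * T] to a finite semigroup separating
[(s, t^3)] from [Y * T].  Let [A] be the set of [x] with [phi (x, t^3)] in
[phi (Y * T)], so that [Y] lies in [A] and [s] does not.  Since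
[phi (a x b, t^3) = phi (a, t) phi (x, t) phi (b, t)], and similarly for
one-sided multiples, the values of [phi] at [(x, t)], [(x, t^2)] and [(x, t^3)]
determine the class of [x] in the syntactic congruence of [A].  This congruence
thus has finite index, and its quotient map separates [s] from [Y]. *)

Local Open Scope classical_set_scope.
Local Open Scope group_scope.
Local Open Scope quotient_scope.

(** [S] may lack an identity, so contexts that are empty on one or both sides need their own
    clauses. *)
Definition syntactic (S : semigroupType) (A : set S) (x y : S) : Prop :=
  [/\ A x <-> A y,
      forall a, A (a * x) <-> A (a * y),
      forall b, A (x * b) <-> A (y * b) &
      forall a b, A (a * x * b) <-> A (a * y * b)].

Lemma syntactic_refl (S : semigroupType) (A : set S) x : syntactic A x x.
Proof. by split. Qed.

Lemma syntactic_sym (S : semigroupType) (A : set S) x y :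
  syntactic A x y -> syntactic A y x.
Proof. by case=> h hl hr hlr; split=> *; apply: iff_sym. Qed.

Lemma syntactic_trans (S : semigroupType) (A : set S) y x z :
  syntactic A x y -> syntactic A y z -> syntactic A x z.
Proof.
case=> h hl hr hlr [k kl kr klr].
by split=> *; [apply: iff_trans k | apply: iff_trans (kl _)
  | apply: iff_trans (kr _) | apply: iff_trans (klr _ _)].
Qed.

Lemma syntactic_mulg (S : semigroupType) (A : set S) x x' y y' :
  syntactic A x x' -> syntactic A y y' -> syntactic A (x * y) (x' * y').
Proof.
move=> [_ _ hr hlr] [_ kl _ klr].
(* One factor is replaced at a time. *)
apply: (@syntactic_trans _ _ (x' * y)); split=> [|a|b|a b];
  rewrite ?mulgA; do ?[exact: hr | exact: hlr | exact: kl | exact: klr].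
- by rewrite -(mulgA x) -(mulgA x'); exact: hr.
- by rewrite -(mulgA (a * x)) -(mulgA (a * x')); exact: hlr.
Qed.

Lemma syntactic_finite_separation (S : semigroupType) (A : set S) (R : Type)
    (f : S -> R) :
  finite_set [set: R] -> (forall x y, f x = f y -> syntactic A x y) ->
  exists (P : semigroupType) (phi : {multiplicative S -> P}),
    finite_set [set: P] /\ (forall x y, phi x = phi y -> A x -> A y).
Proof.
move=> finR fA.
pose r x y := `[< syntactic A x y >].
have rxx : reflexive r by move=> x; apply/asboolP; exact: syntactic_refl.
have rC : symmetric r.
  by move=> x y; apply/asboolP/asboolP; exact: syntactic_sym.
have rT : transitive r.
  by move=> y x z /asboolP xy /asboolP yz; apply/asboolP/(syntactic_trans xy).
pose Q := {eq_quot EquivRel r rxx rC rT}.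
have piP x y : \pi_Q x = \pi_Q y <-> syntactic A x y.
  by split=> [/eqmodP/asboolP|h] //; apply/eqmodP/asboolP.
pose mul (p q : Q) := \pi_Q (repr p * repr q).
have piM x y : mul (\pi_Q x) (\pi_Q y) = \pi_Q (x * y).
  by apply/piP/syntactic_mulg; apply/piP; rewrite reprK.
have mulA : associative mul.
  move=> p q u; rewrite -[p]reprK -[q]reprK -[u]reprK.
  move: (repr p) (repr q) (repr u) => x y z.
  by rewrite (piM y z) (piM x y) (piM x (y * z)) (piM (x * y) z) mulgA.
pose P : semigroupType := HB.pack Q (isSemigroup.Build Q mulA).
pose piH := isMultiplicative.Build S P (\pi_Q) (fun x y => esym (piM x y)).
pose phi : {multiplicative S -> P} := HB.pack (\pi_Q : S -> P) piH.
exists P, phi; split; last by move=> x y /piP[[]].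
(* The value of [f] at its representative determines a class, so [Q] injects into the finite type
   [R]. *)
rewrite -(preimage_setT (fun q : Q => f (repr q))).
apply: finite_preimage => // p q _ _ /fA /piP.
by rewrite !reprK.
Qed.

(* Stated for a surjection [pr] with a family of sections [j] indexed by [T], so
that both projections of a direct product are instances. *)
Lemma strongly_subsemigroup_separable_section (U S T : semigroupType)
    (pr : U -> S) (j : S -> T -> U) :
  [set: T] !=set0 ->
  {morph pr : u v / u * v} -> (forall x t, pr (j x t) = x) ->
  (forall x y t t', j x t * j y t' = j (x * y) (t * t')) ->
  strongly_subsemigroup_separable U -> strongly_subsemigroup_separable S.
Proof.
move=> [t _] prM prK jM sepU s Y [[y0 Yy0] YM] nYs.
have [||P [phi [finP nphi]]] := sepU (j s (t * t * t)) (pr @^-1` Y).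
- split; first by exists (j y0 t); rewrite /preimage /= prK.
  by move=> u v; rewrite /preimage /= prM; exact: YM.
- by rewrite /preimage /= prK.
pose A := [set x | (phi @` (pr @^-1` Y)) (phi (j x (t * t * t)))].
pose f x := (phi (j x t), phi (j x (t * t)), phi (j x (t * t * t))).
have [||Q [psi [finQ psiA]]] := @syntactic_finite_separation S A _ f.
- by rewrite -!setXTT; do 2?apply: finite_setX.
- move=> x y [e1 e2 e3]; rewrite /syntactic /A /=; split=> [|a|b|a b].
  + by rewrite e3.
  (* Reassociating the cube as [t * (t * t)] pairs [a] with [t] and [x] with the square, as [e2]
     requires. *)
  + by rewrite -mulgA -!jM !gmulfM e2.
  + by rewrite -!jM !gmulfM e2.
  + by rewrite -!jM !gmulfM e1.
(* If [psi y = psi s], then [s] would inherit membership in [A] from [y], against [nphi]. *)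
exists Q, psi; split=> // -[y Yy] /psiA; apply: contra_not nphi; apply.
by exists (j y (t * t * t)) => //; rewrite /preimage /= prK.
Qed.

(* A semigroupType may be empty, whereas semigroups here are nonempty. *)
Theorem theorem3p3 (S T : semigroupType)
    (S_nonempty : [set: S] !=set0) (T_nonempty : [set: T] !=set0) :
  strongly_subsemigroup_separable (S * T)%type ->
  strongly_subsemigroup_separable S /\ strongly_subsemigroup_separable T.
Proof.
move=> sepST; split.
- exact: (@strongly_subsemigroup_separable_section (S * T)%type S T fst pair).
- exact: (@strongly_subsemigroup_separable_section (S * T)%type T S snd
    (fun y x => (x, y))).
Qed.
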